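(* Let $G$ be a graph admitting an arithmetic IASI $f$, and let $v_i,v_j$ be adjacent vertices of $G$ with deterministic indices $d_i$ and $d_j$ respectively, where $d_i<d_j$. Then there is a positive integer $k$ with $1\le k\le |f(v_i)|$ such that $|f^+(v_iv_j)|=|f(v_i)|+k(|f(v_j)|-1)$.
   Context: All graphs are simple, finite and have no isolated vertices. $\mathbb{N}_0$ is the set of non-negative integers; all sets considered are finite. For $A,B\subseteq\mathbb{N}_0$, $A+B=\{a+b: a\in A, b\in B\}$. An integer additive set-indexer (IASI) of $G$ is an injective function $f:V(G)\to 2^{\mathbb{N}_0}$ such that the induced function $f^+:E(G)\to 2^{\mathbb{N}_0}$, $f^+(uv)=f(u)+f(v)$, is also injective. An AP-set is a finite set of non-negative integers whose elements, in increasing order, form an arithmetic progression; its common difference is called the deterministic index of the element (vertex or edge) it labels. An IASI $f$ is an arithmetic IASI if $f(v)$ is an AP-set for every vertex $v$ and $f^+(e)$ is an AP-set for every edge $e$. *)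

(* Defs.v *)
From HB Require Import structures.
From mathcomp Require Import all_boot all_order finmap.

Set Implicit Arguments.
Unset Strict Implicit.
Unset Printing Implicit Defensive.

Local Open Scope fset_scope.

Record graph := Graph {
  vertex :> finType;
  adj : rel vertex;
  adj_sym : symmetric adj;
  adj_irr : irreflexive adj;
  no_isolated : forall u, exists v, adj u v
}.

Definition sumset (A B : {fset nat}) : {fset nat} :=
  [fset (a + b)%N | a in A, b in B].

Lemma sumsetC A B : sumset A B = sumset B A.
Proof.
by apply/fsetP => x; apply/imfset2P/imfset2P => -[a aA [b bB ->]];
  exists b => //; exists a => //; rewrite addnC.
Qed.

(* By sumsetC the label depends only on the unordered edge {u, v}. *)
Definition edge_label (G : graph) (f : G -> {fset nat}) (u v : G) : {fset nat} :=
  sumset (f u) (f v).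

Definition IASI (G : graph) (f : G -> {fset nat}) : Prop :=
  injective f /\
  forall u v x y : G, adj u v -> adj x y ->
    edge_label f u v = edge_label f x y -> [set u; v] = [set x; y].

(* A progression has a first term, so the empty set is excluded.  On a set   *)
(* with at least two elements d is unique and positive; a singleton is a     *)
(* one-term progression, which every d fits.                                 *)
Definition common_difference (A : {fset nat}) (d : nat) : Prop :=
  A != fset0 /\
  exists a : nat, sort leq A = mkseq (fun i => (a + i * d)%N) #|` A|.

Definition AP_set (A : {fset nat}) : Prop := exists d, common_difference A d.

Definition deterministic_index (G : graph) (f : G -> {fset nat}) (v : G)
    (d : nat) : Prop :=
  common_difference (f v) d.

Definition arithmetic_IASI (G : graph) (f : G -> {fset nat}) : Prop :=
  [/\ IASI f,
      forall v : G, AP_set (f v)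
    & forall u v : G, adj u v -> AP_set (edge_label f u v)].

(* Main.v *)
Require Import Defs.
From HB Require Import structures.
From mathcomp Require Import all_boot all_order finmap.
From mathcomp Require Import zify.

Set Implicit Arguments.
Unset Strict Implicit.
Unset Printing Implicit Defensive.

(** Write [A = a + d {0, .., m-1}] and [B = b + e {0, .., n-1}] with [d < e].
    If [m, n >= 2], the two smallest elements of [A + B] are [a + b] and
    [a + b + d], so the difference of the progression [A + B] is [d].  As
    [a + b + e] lies in [A + B], [e = k d] for some [k]; comparing the largest
    elements gives [|A + B| = m + k (n - 1)].  The term [a + b + m d] is in
    [A + B] but not in [A + b], which forces [k <= m].  If [m = 1] or [n = 1],
    then [k = 1] works. *)

Lemma common_difference_card_gt0 (A : {fset nat}) (d : nat) :
  common_difference A d -> 0 < #|` A|.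
Proof. by case=> A0 _; rewrite cardfs_gt0. Qed.

Lemma common_differenceP (A : {fset nat}) (d : nat) :
  common_difference A d ->
  exists a, forall x, x \in A <-> exists2 i, i < #|` A| & x = a + i * d.
Proof.
case=> _ [a sA]; exists a => x.
have -> : (x \in A) = (x \in mkseq (fun i => a + i * d) #|` A|).
  by rewrite -sA mem_sort.
by split=> [/mapP|] [i iA ->]; [|apply/mapP]; exists i;
  rewrite // mem_iota in iA *.
Qed.

(** If [d = 0], every term equals the first one, so [A] lies in a singleton. *)
Lemma common_difference_gt0 (A : {fset nat}) (d : nat) :
  common_difference A d -> 1 < #|` A| -> 0 < d.
Proof.
move=> cA; case: d cA => // cA; have [a Aa] := common_differenceP cA.
suff /fsubset_leq_card : (A `<=` [fset a])%fset by rewrite cardfs1; lia.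
by apply/fsubsetP => x /Aa[i _ ->]; rewrite inE muln0 addn0.
Qed.

Lemma sumset_progressionP (A B : {fset nat}) (d e : nat) :
  common_difference A d -> common_difference B e ->
  exists s, forall x, x \in sumset A B <->
    exists i j, [/\ i < #|` A|, j < #|` B| & x = s + (i * d + j * e)].
Proof.
move=> /common_differenceP[a Aa] /common_differenceP[b Bb]; exists (a + b) => x.
split=> [/imfset2P/=[y /Aa[i im ->] [z /Bb[j jn ->] ->]]|].
  by exists i, j; split=> //; lia.
move=> [i [j [im jn ->]]]; apply/imfset2P; exists (a + i * d); first by apply/Aa; exists i.
by exists (b + j * e); [apply/Bb; exists j | lia].
Qed.

(** Adding a singleton is a translation, which is injective. *)
Lemma card_sumset1 (A : {fset nat}) (c : nat) :
  #|` sumset [fset c]%fset A| = #|` A|.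
Proof.
have -> : sumset [fset c]%fset A = [fset (c + x)%N | x in A]%fset.
  apply/fsetP => x; apply/imfset2P/imfsetP => /= [[y]|[z zA ->]].
    by rewrite inE => /eqP -> [z zA ->]; exists z.
  by exists c; [rewrite inE | exists z].
by rewrite card_imfset //= => x y /addnI.
Qed.

Lemma card_sumset_AP (A B : {fset nat}) (d e : nat) :
  common_difference A d -> common_difference B e -> d < e ->
  AP_set (sumset A B) ->
  exists k, 1 <= k <= #|` A| /\ #|` sumset A B| = #|` A| + k * (#|` B| - 1).
Proof.
move=> cA cB lt_de [D cS].
have m0 := common_difference_card_gt0 cA; have n0 := common_difference_card_gt0 cB.
have [m1|m2] := leqP #|` A| 1.
  have /eqP/cardfs1P[c Ac] : #|` A| = 1 by lia.
  by exists 1; rewrite Ac card_sumset1 cardfs1; lia.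
have [n1|n2] := leqP #|` B| 1.
  have /eqP/cardfs1P[c Bc] : #|` B| = 1 by lia.
  by exists 1; rewrite Bc sumsetC card_sumset1 cardfs1; lia.
have d0 := common_difference_gt0 cA m2.
have [s0 sumP] := sumset_progressionP cA cB; have [s SP] := common_differenceP cS.
move: (sumset A B) (common_difference_card_gt0 cS) sumP SP => S N0 sumP SP {cS cA cB}.
set m := #|` A| in m0 m2 sumP *; set n := #|` B| in n0 n2 sumP *.
set N := #|` S| in N0 SP *.
have inS i j : i < m -> j < n -> exists2 p, p < N & s0 + (i * d + j * e) = s + p * D.
  by move=> im jn; apply/SP/sumP; exists i, j.
have ofS p : p < N ->
    exists i j, [/\ i < m, j < n & s + p * D = s0 + (i * d + j * e)].
  by move=> pN; apply/sumP/SP; exists p.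
(* Both are the least element of [S]: each is at most the other. *)
have ss0 : s = s0.
  have [p _ E1] := inS 0 0 m0 n0; have [i [j [_ _ E2]]] := ofS 0 N0; lia.
subst s0.
(* Since [d] is a positive multiple of [D], [0 < D <= d]. Also [D = i * d + j * e]: [i = 0] would
   give [D = 0] or [D >= e > d], so [i > 0] and [D >= d]. *)
have Dd : D = d.
  have [p pN E1] := inS 1 0 m2 n0.
  have p0 : 0 < p by case: p E1 {pN} => //; lia.
  have [i [j [_ _ E2]]] := ofS 1 (leq_ltn_trans p0 pN).
  by case: i E2 => [|i]; [case: j => [|j]|]; nia.
subst D.
have [k _ Ek] := inS 0 1 m0 n2.
have {}Ek : e = k * d by lia.
subst e.
have k0 : 0 < k by nia.
have NE : N = m + k * (n - 1).
  (* The largest sum has index [p < N], which bounds [N] from below. *)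
  have [p pN E1] : exists2 p, p < N & s + ((m - 1) * d + (n - 1) * (k * d)) = s + p * d.
    by apply: inS; lia.
  have {E1} Ep : (m - 1) + (n - 1) * k = p.
    by apply/eqP; rewrite -(eqn_pmul2r d0); apply/eqP; lia.
  (* Conversely, the last term is a sum with [i <= m - 1] and [j <= n - 1], which bounds [N] from
     above. *)
  have [|i [j [im jn E2]]] := ofS (N - 1); first by lia.
  have {E2} Eq : N - 1 = i + j * k.
    by apply/eqP; rewrite -(eqn_pmul2r d0); apply/eqP; lia.
  have : j * k <= (n - 1) * k by apply: leq_mul => //; lia.
  lia.
exists k; split=> //; rewrite k0 /=.
(* Index [m] is in range because [k * (n - 1) > 0]. As [i < m], the equation [m = i + j * k] forces
   [j > 0], hence [k <= m]. *)
have [|i [j [im jn E]]] := ofS m; first by rewrite NE; nia.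
have {}E : m = i + j * k.
  by apply/eqP; rewrite -(eqn_pmul2r d0); apply/eqP; lia.
case: j E {jn} => [|j]; nia.
Qed.

Theorem theorem2p12 (G : graph) (f : G -> {fset nat}) (vi vj : G)
    (di dj : nat) :
  arithmetic_IASI f ->
  adj vi vj ->
  deterministic_index f vi di ->
  deterministic_index f vj dj ->
  (di < dj)%N ->
  exists k : nat, (1 <= k <= #|` f vi|)%N /\
    #|` edge_label f vi vj| = (#|` f vi| + k * (#|` f vj| - 1))%N.
Proof.
move=> [_ _ edgeAP] adj_ij di_f dj_f lt_ij.
exact: card_sumset_AP di_f dj_f lt_ij (edgeAP _ _ adj_ij).
Qed.
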